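(* Let $\mathcal M$ be a class of Borel probability distributions on $\mathbb R$, and let $SI_\alpha$ denote the shortest $\alpha$-prediction interval functional. (i) Let $\alpha\in(0,1)$. If $\mathcal M$ contains (a) all distributions with bounded Lebesgue densities, or (b) all distributions on $\mathbb N_0$ which are unimodal with mode $k$ for some $k\ge1$, then $SI_\alpha$ is not selectively elicitable on $\mathcal M$. Moreover, $SI_\alpha$ cannot be selectively elicited even with a scoring function that is not $\mathcal M$-finite; i.e. there is no strictly $\mathcal M$-consistent selective scoring function $S\colon U\times\mathbb R\to(-\infty,\infty]$ for $SI_\alpha$, $\mathcal M$-finite or not. (ii) Let $\alpha\in(0,1]$. If for some $x\ne y\in\mathbb R$ one has $\{(1-\lambda)\delta_x+\lambda\delta_y:\lambda\in[0,1]\}\subseteq\mathcal M$, then $SI_\alpha$ is not exhaustively elicitable on $\mathcal M$ (with $\mathcal M$-finite scores).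
   Context: $\bar{\mathbb R}=\mathbb R\cup\{-\infty,\infty\}$, $\bar U=\{(a,b)^\top\in\bar{\mathbb R}^2:a\le b\}$, $U=\{(a,b)^\top\in\mathbb R^2:a\le b\}$; a vector $(a,b)^\top\in\bar U$ is identified with the interval $[a,b]$, and $F([a,b]):=F([a,b]\cap\mathbb R)$. $\mathcal I_\alpha(F)=\{(a,b)^\top\in\bar U:F([a,b])\ge\alpha\}$. For $\alpha\in(0,1)$, $$SI_\alpha(F)=\{(a,b)^\top\in\mathcal I_\alpha(F): b-a\le d-c\ \text{for all }(c,d)^\top\in\mathcal I_\alpha(F),\ c,d\in\mathbb R\}$$ (a set of finite intervals), and $SI_1(F)=\{(\operatorname{ess\,inf}(F),\operatorname{ess\,sup}(F))^\top\}$, where $\operatorname{ess\,inf}(F)$ and $\operatorname{ess\,sup}(F)$ are the left and right endpoints (in $\bar{\mathbb R}$) of the support of $F$. A distribution on $\mathbb N_0$ is unimodal with mode $k$ if its probability mass function is nondecreasing on $\{0,\dots,k\}$ and nonincreasing on $\{k,k+1,\dots\}$. For a scoring function $S\colon\mathsf A\times\mathbb R\to(-\infty,\infty]$ let $\bar S(x,F)=\int S(x,y)\,dF(y)$, assumed to exist in $(-\infty,\infty]$ for $x\in\mathsf A$, $F\in\mathcal M$; $S$ is $\mathcal M$-finite if $\bar S(x,F)<\infty$ for all $x\in\mathsf A,F\in\mathcal M$. Selective case ($\mathsf A=U$): $S$ is strictly $\mathcal M$-consistent for $T$ if $\bar S(t,F)\le\bar S(x,F)$ for all $x\in U$, $t\in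 T(F)$, $F\in\mathcal M$, with equality only if $x\in T(F)$. Exhaustive case ($\mathsf A=\mathsf A_{\mathrm{exh}}\subseteq2^{\bar U}$ a collection of sets containing all $T(F)$, $F\in\mathcal M$): $S$ is strictly $\mathcal M$-consistent for $T$ if $\bar S(T(F),F)\le\bar S(B,F)$ for all $B\in\mathsf A_{\mathrm{exh}}$, $F\in\mathcal M$, with equality only if $B=T(F)$. $T$ is selectively (exhaustively) elicitable on $\mathcal M$ if a strictly $\mathcal M$-consistent, $\mathcal M$-finite selective (exhaustive) scoring function exists. *)

(* Defs.v *)
From HB Require Import structures.
From mathcomp Require Import all_boot all_order all_algebra.
From mathcomp Require Import all_classical all_reals all_analysis.
From mathcomp Require Import measurable_realfun.

Set Implicit Arguments.
Unset Strict Implicit.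
Unset Printing Implicit Defensive.

Import Order.TTheory GRing.Theory Num.Theory.
Import numFieldNormedType.Exports.

Local Open Scope classical_set_scope.
Local Open Scope ring_scope.
Local Open Scope ereal_scope.

Notation distr R := (probability (measurableTypeR R) R).

Definition Ubar (R : realType) : set (\bar R * \bar R) :=
  [set p | p.1 <= p.2].

Definition U (R : realType) : set (R * R) := [set p | (p.1 <= p.2)%R].

Definition emb (R : realType) (p : R * R) : \bar R * \bar R :=
  (p.1%:E, p.2%:E).

(* [a, b] intersected with the real line. *)
Definition real_part (R : realType) (p : \bar R * \bar R) : set R :=
  [set y : R | p.1 <= y%:E <= p.2].

Definition I_ (R : realType) (alpha : R) (F : distr R) :
    set (\bar R * \bar R) :=
  [set p | Ubar p /\ alpha%:E <= F (real_part p)].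

Definition supp (R : realType) (F : distr R) : set R :=
  [set x : R | forall O : set R, open O -> O x -> 0 < F O].

Definition essinf (R : realType) (F : distr R) : \bar R :=
  ereal_inf (EFin @` supp F).

Definition esssup (R : realType) (F : distr R) : \bar R :=
  ereal_sup (EFin @` supp F).

(* The convention +oo - +oo = -oo is harmless: for 0 < alpha, (+oo, +oo) and
   (-oo, -oo) are not in I_ alpha F, as their real parts are empty. *)
Definition SI (R : realType) (alpha : R) (F : distr R) :
    set (\bar R * \bar R) :=
  if alpha == 1%R then [set (essinf F, esssup F)]
  else [set p | I_ alpha F p /\
         forall c d : R, I_ alpha F (c%:E, d%:E) -> p.2 - p.1 <= d%:E - c%:E].

Definition sbar (R : realType) (X : Type) (S : X -> R -> \bar R) (x : X)
    (F : distr R) : \bar R :=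
  \int[F]_y S x y.

(* S is only constrained on the action domain A; the values of S outside A are
   never used. Finiteness of the integral of the negative part says that sbar
   exists in (-oo, +oo]. *)
Definition scoring_function (R : realType) (X : Type) (A : set X)
    (M : set (distr R)) (S : X -> R -> \bar R) : Prop :=
  forall x, A x ->
    [/\ forall y, -oo < S x y,
        measurable_fun [set: R] (S x) &
        forall F, M F -> \int[F]_y ((S x)^\- y) < +oo].

Definition finite_score (R : realType) (X : Type) (A : set X)
    (M : set (distr R)) (S : X -> R -> \bar R) : Prop :=
  forall x F, A x -> M F -> sbar S x F < +oo.

Definition sel_strictly_consistent (R : realType) (M : set (distr R))
    (T : distr R -> set (\bar R * \bar R)) (S : R * R -> R -> \bar R) : Prop :=
  forall (F : distr R) (t x : R * R), M F -> U t -> T F (emb t) -> U x ->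
    sbar S t F <= sbar S x F /\ (sbar S t F = sbar S x F -> T F (emb x)).

Definition exh_strictly_consistent (R : realType)
    (A : set (set (\bar R * \bar R))) (M : set (distr R))
    (T : distr R -> set (\bar R * \bar R))
    (S : set (\bar R * \bar R) -> R -> \bar R) : Prop :=
  forall (F : distr R) (B : set (\bar R * \bar R)), M F -> A B ->
    sbar S (T F) F <= sbar S B F /\ (sbar S (T F) F = sbar S B F -> B = T F).

Definition selectively_elicitable (R : realType) (M : set (distr R))
    (T : distr R -> set (\bar R * \bar R)) : Prop :=
  exists S : R * R -> R -> \bar R,
    [/\ scoring_function (@U R) M S, finite_score (@U R) M S &
        sel_strictly_consistent M T S].

Definition exhaustive_domain (R : realType) (M : set (distr R))
    (T : distr R -> set (\bar R * \bar R))
    (A : set (set (\bar R * \bar R))) : Prop :=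
  (forall B, A B -> B `<=` @Ubar R) /\ (forall F, M F -> A (T F)).

Definition exhaustively_elicitable (R : realType) (M : set (distr R))
    (T : distr R -> set (\bar R * \bar R)) : Prop :=
  exists (A : set (set (\bar R * \bar R)))
         (S : set (\bar R * \bar R) -> R -> \bar R),
    [/\ exhaustive_domain M T A, scoring_function A M S, finite_score A M S &
        exh_strictly_consistent A M T S].

Definition bounded_density (R : realType) : set (distr R) :=
  [set F : distr R | exists f : R -> R,
    [/\ measurable_fun [set: R] f,
        forall y, (0 <= f y)%R,
        exists C : R, forall y, (f y <= C)%R &
        forall B : set R, measurable B ->
          F B = \int[lebesgue_measure]_(y in B) (f y)%:E]].

Definition pmfN (R : realType) (F : distr R) (n : nat) : \bar R :=
  F [set (n%:R : R)].

Definition unimodal (R : realType) (k : nat) : set (distr R) :=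
  [set F : distr R | [/\ F (range (fun n : nat => (n%:R : R))) = 1,
    forall m n, (m <= n <= k)%N -> pmfN F m <= pmfN F n &
    forall m n, (k <= m <= n)%N -> pmfN F n <= pmfN F m]].

Definition two_point_mixtures (R : realType) (x y : R) : set (distr R) :=
  [set F : distr R | exists2 l : R, (0 <= l <= 1)%R &
    forall B : set R, measurable B ->
      F B = (1 - l)%:E * \d_x B + l%:E * \d_y B].

(* Main.v *)
(* Expected scores are affine in the distribution, so a strict inequality between
   the expected scores of two fixed actions cannot reverse at once when one leaves
   the endpoint [P] of a segment [(1 - s) P + s Q].  Each part exhibits a segment
   on which the shortest interval jumps at [s = 0].

   Densities: [P] puts mass [alpha] on the isolated interval [0, 1], and [Q] moves
   it to another block [3, 3 + K], the rest being spread thinly far away.  For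
   [0 < s < 1] the shortest interval is [0, 3 + K], however small [s] is, since
   there is no mass in the gap.
   Unimodal laws: [P] has an atom of mass exactly [alpha] at the mode [k], every
   other atom being smaller, and [Q] is uniform on [k, ..., k + n] with atoms
   between [alpha / 2] and [alpha], so that [k, k] is replaced by [k, k + 1].
   Scores that are not finite are handled by showing that the score of the interval
   optimal under [P] is finite under [Q], because that interval is also strictly
   better than some other one under a distribution dominating [Q].
   Two-point laws: the set of shortest intervals itself is constant for
   [0 < s < 1] and different at [s = 0]. *)
Require Import Defs.
From HB Require Import structures.
From mathcomp Require Import all_boot all_order all_algebra.
From mathcomp Require Import all_classical all_reals all_analysis.
From mathcomp Require Import measurable_realfun.
From mathcomp Require Import lra ring zify.

Set Implicit Arguments.
Unset Strict Implicit.

Import Order.TTheory GRing.Theory Num.Theory.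
Import numFieldNormedType.Exports.

Local Open Scope classical_set_scope.
Local Open Scope ring_scope.

(** * Mixtures of two probability distributions *)

Section mixture.
Context {R : realType}.
Variables (s : R) (s01 : 0 <= s <= 1) (P Q : distr R).

Lemma mixture_weight_ge0 : 0 <= s.
Proof. by case/andP: s01. Qed.

Lemma mixture_coweight_ge0 : 0 <= 1 - s.
Proof. by rewrite subr_ge0; case/andP: s01. Qed.

Definition mix : set (measurableTypeR R) -> \bar R :=
  measure_add (mscale (NngNum mixture_coweight_ge0) P)
              (mscale (NngNum mixture_weight_ge0) Q).

HB.instance Definition _ := Measure.on mix.

Lemma mixE B : mix B = ((1 - s)%:E * P B + s%:E * Q B)%E.
Proof. by rewrite /mix measure_addE. Qed.

Let mix_setT : mix setT = 1%E.
Proof. by rewrite mixE !probability_setT !mule1 -EFinD subrK. Qed.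

HB.instance Definition _ := Measure_isProbability.Build _ _ _ mix mix_setT.

Lemma ge0_integral_mix (f : R -> \bar R) : measurable_fun setT f ->
  (forall x, (0 <= f x)%E) ->
  (\int[mix]_x f x = (1 - s)%:E * \int[P]_x f x + s%:E * \int[Q]_x f x)%E.
Proof.
by move=> mf f0; rewrite ge0_integral_measure_add// !ge0_integral_mscale.
Qed.

End mixture.

(** * Affinity of expected scores with values in the extended reals *)

Section scores.
Context {R : realType}.
Local Open Scope ereal_scope.

Lemma sbar_gtNy (X : Type) (S : X -> R -> \bar R) x (F : distr R) :
  \int[F]_y ((S x)^\- y) < +oo -> -oo < sbar S x F.
Proof.
move=> h; rewrite /sbar integralE.
have : 0 <= \int[F]_y (S x)^\+ y by exact: integral_ge0.
have : 0 <= \int[F]_y (S x)^\- y by exact: integral_ge0.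
by move: h; case: (\int[F]_y (S x)^\- y) => [a| |]//; case: (\int[F]_y (S x)^\+ y) => [b| |]// _ _ _; rewrite ?ltNyr ?ltry.
Qed.

(** Used with [a], [b] the integrals of the positive parts and [c], [d] those of the negative parts.
    As [c] and [d] are real, no [+oo - +oo] arises; the endpoints, where a zero weight may meet
    [+oo], are treated apart. *)
Lemma mixture_subE (a b c d : \bar R) s : (0 <= s <= 1)%R ->
  0 <= a -> 0 <= b -> 0 <= c < +oo -> 0 <= d < +oo ->
  ((1 - s)%:E * a + s%:E * b) - ((1 - s)%:E * c + s%:E * d) =
  (1 - s)%:E * (a - c) + s%:E * (b - d).
Proof.
move=> /andP[]; rewrite le_eqVlt => /predU1P[<-|s0].
  by rewrite subr0 !mul1e !mul0e !adde0.
rewrite le_eqVlt => /predU1P[->|s1].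
  by rewrite subrr !mul1e !mul0e !add0e.
have s1' : (0 < 1 - s)%R by rewrite subr_gt0.
move=> a0 b0; case: c => [c| |]; case: d => [d| |]; rewrite ?ltxx ?andbF// => _ _.
move: a0 b0; case: a => [a| |]//; case: b => [b| |]// _ _.
- have e : ((1 - s) * a + s * b - ((1 - s) * c + s * d) =
           (1 - s) * (a - c) + s * (b - d))%R by ring.
  exact: (congr1 EFin e).
- by rewrite addye// !gt0_muley// addey.
- by rewrite addye// !gt0_muley// !addye.
- by rewrite !addye// !gt0_muley// addye.
Qed.

Lemma sbar_mix (X : Type) (S : X -> R -> \bar R) x (P Q : distr R) s
    (s01 : (0 <= s <= 1)%R) : measurable_fun setT (S x) ->
  \int[P]_y ((S x)^\- y) < +oo -> \int[Q]_y ((S x)^\- y) < +oo ->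
  sbar S x (mix s01 P Q) = (1 - s)%:E * sbar S x P + s%:E * sbar S x Q.
Proof.
move=> mS hP hQ; rewrite /sbar [LHS]integralE [in RHS]integralE.
rewrite [X in _ + _ * X]integralE.
rewrite ge0_integral_mix; [|exact: measurable_funepos|by []].
rewrite ge0_integral_mix; [|exact: measurable_funeneg|by []].
by apply: mixture_subE => //; rewrite ?integral_ge0.
Qed.

Lemma mixture_ltey (a b : \bar R) s : (0 < s < 1)%R ->
  -oo < a -> -oo < b -> (1 - s)%:E * a + s%:E * b < +oo -> a < +oo /\ b < +oo.
Proof.
move=> /andP[s0 s1]; case: a => [a| |]//; case: b => [b| |]// _ _;
  rewrite ?ltry// !(gt0_muley, addey, addye, mulry, gtr0_sg, mul1e)//= ?lte_fin ?subr_gt0//.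
Qed.

(* Both sides are affine in [s], so the strict inequality at [s = 0] persists
   for small [s], unless infinite values interfere. *)
Lemma affine_no_jump (u0 u1 v0 v1 : \bar R) :
  -oo < u0 -> -oo < u1 -> -oo < v0 -> -oo < v1 ->
  u0 < v0 -> u1 < +oo ->
  ~ (forall s : R, (0 < s < 1)%R ->
       (1 - s)%:E * v0 + s%:E * v1 < (1 - s)%:E * u0 + s%:E * u1).
Proof.
move=> u0y u1y v0y v1y uv0 u1oo h.
(* One strict inequality at an interior point already forces [v0] and [v1], and then [u0], to be
   real. *)
have h12 : (0 < (1 / 2 : R) < 1)%R by lra.
have [v0oo v1oo] := mixture_ltey h12 v0y v1y (lt_le_trans (h _ h12) (leey _)).
have u0oo : u0 < +oo := lt_trans uv0 v0oo.
move: u0 u1 v0 v1 u0y u1y v0y v1y uv0 u1oo h v0oo v1oo u0oo.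
move=> [u0| |]// [u1| |]// [v0| |]// [v1| |]// _ _ _ _; rewrite lte_fin => uv0 _ h _ _ _.
(* With initial gap [d] and final gap at least [- e], the gap at [s] is at least [d - s (d + e)],
   which is still positive at [s = d / (2 d + e)]. *)
pose d := (v0 - u0)%R; pose e := `|v1 - u1|%R.
have d0 : (0 < d)%R by rewrite subr_gt0.
have e0 : (0 <= e)%R by exact: normr_ge0.
have de : (0 < d + e + d)%R by lra.
have := h (d / (d + e + d))%R; rewrite divr_gt0// ltr_pdivrMr// mul1r.
rewrite (_ : (d < d + e + d)%R) => [/(_ isT)|]; last lra.
rewrite -!EFinM -!EFinD lte_fin.
set s := (d / _)%R => hs.
have sE : (s * (d + e + d) = d)%R by rewrite divfK// gt_eqF.
have s0 : (0 < s)%R by rewrite divr_gt0.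
have : (- e <= v1 - u1)%R by rewrite /e lerNl -normrN ler_norm.
move=> he; have : (s * (- e) <= s * (v1 - u1))%R by rewrite ler_pM2l.
rewrite /d in sE, d0 *; nra.
Qed.

End scores.

(** * Jumps of a functional along a segment *)

Section elicitability.
Context {R : realType}.
Local Open Scope ereal_scope.
Variables (M : set (distr R)) (T : distr R -> set (\bar R * \bar R)).

(** Both weights are positive and no score is [-oo], so an infinite component would make the mixture
    infinite. This supplies finiteness when [S] is not assumed [M]-finite. *)
Lemma sbar_mix_ltey (X : Type) (A : set X) (S : X -> R -> \bar R) x
    (P Q : distr R) s (s01 : (0 <= s <= 1)%R) :
  scoring_function A M S -> A x -> M P -> M Q -> (0 < s < 1)%R ->
  sbar S x (mix s01 P Q) < +oo -> sbar S x P < +oo /\ sbar S x Q < +oo.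
Proof.
move=> scS Ax MP MQ s01'; have [_ mS fS] := scS x Ax.
rewrite sbar_mix//; [|exact: fS|exact: fS].
by apply: mixture_ltey => //; apply: sbar_gtNy; exact: fS.
Qed.

Lemma sel_strictly_consistent_lt (S : R * R -> R -> \bar R) (F : distr R)
    (t x : R * R) :
  sel_strictly_consistent M T S -> M F -> U t -> U x ->
  T F (emb t) -> ~ T F (emb x) -> sbar S t F < sbar S x F.
Proof.
move=> cS MF Ut Ux Tt Tx; have [le_tx eq_tx] := cS F t x MF Ut Tt Ux.
by rewrite lt_neqAle le_tx andbT; apply/eqP => /eq_tx.
Qed.

(** The conclusion concerns finiteness because a score of [t] that is infinite under [Q] would make
    the jump possible; each application refutes it separately. *)
Lemma selective_jump (S : R * R -> R -> \bar R) (P Q : distr R)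
    (t x : R * R) :
  scoring_function (@U R) M S -> sel_strictly_consistent M T S ->
  M P -> M Q -> U t -> U x -> T P (emb t) -> ~ T P (emb x) ->
  (forall s (s01 : (0 <= s <= 1)%R), (0 < s < 1)%R ->
     [/\ M (mix s01 P Q), T (mix s01 P Q) (emb x) &
         ~ T (mix s01 P Q) (emb t)]) ->
  ~ sbar S t Q < +oo.
Proof.
move=> scS cS MP MQ Ut Ux Tt Tx Tmix tQ.
have [_ mSt fSt] := scS t Ut; have [_ mSx fSx] := scS x Ux.
apply: (@affine_no_jump _ (sbar S t P) (sbar S t Q) (sbar S x P) (sbar S x Q)) => //;
  try by apply: sbar_gtNy; (exact: fSt || exact: fSx).
  exact: sel_strictly_consistent_lt.
move=> s s01; have s01' : (0 <= s <= 1)%R by lra.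
rewrite -!(sbar_mix s01')//; try by (exact: fSt || exact: fSx).
by have [Mm Tm nTm] := Tmix s s01' s01; exact: sel_strictly_consistent_lt.
Qed.

Lemma exhaustive_jump (P Q : distr R) (B : set (\bar R * \bar R)) :
  M P -> M Q -> T P <> B ->
  (forall s (s01 : (0 <= s <= 1)%R), (0 < s < 1)%R ->
     M (mix s01 P Q) /\ T (mix s01 P Q) = B) ->
  ~ exhaustively_elicitable M T.
Proof.
move=> MP MQ TPB Tmix [A [S [[_ AT] scS finS cS]]].
have ATP : A (T P) by exact: AT.
(* [B] is an admissible action because it is the value of [T] at the midpoint of the segment. *)
have AB : A B.
  have h01 : (0 <= (1 / 2 : R) <= 1)%R by lra.
  have [|Mm <-] := Tmix _ h01; first by lra.
  exact: AT.
have [_ mSt fSt] := scS _ ATP; have [_ mSx fSx] := scS _ AB.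
apply: (@affine_no_jump _ (sbar S (T P) P) (sbar S (T P) Q) (sbar S B P) (sbar S B Q)) => //;
  try by apply: sbar_gtNy; (exact: fSt || exact: fSx).
- have [le1 eq1] := cS P B MP AB.
  by rewrite lt_neqAle le1 andbT; apply/eqP => /eq1/esym.
- exact: finS.
move=> s s01; have s01' : (0 <= s <= 1)%R by lra.
rewrite -!(sbar_mix s01')//; try by (exact: fSt || exact: fSx).
have [Mm Tm] := Tmix s s01' s01.
have [] := cS _ (T P) Mm ATP; rewrite Tm => le1 eq1.
by rewrite lt_neqAle le1 andbT; apply/eqP => /eq1.
Qed.

End elicitability.

(** * Shortest intervals of two-point distributions *)

Section shortest_intervals.
Context {R : realType}.
Implicit Types (F : distr R) (alpha a b c d x y l : R).

Lemma real_part_emb a b : real_part (emb (a, b)) = `[a, b]%classic.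
Proof. by apply/seteqP; split=> z; rewrite /real_part/= in_itv/= !lee_fin. Qed.

Lemma SI_embP alpha F a b : alpha != 1 ->
  SI alpha F (emb (a, b)) <->
  [/\ a <= b, (alpha%:E <= F `[a, b]%classic)%E &
      forall c d, c <= d -> (alpha%:E <= F `[c, d]%classic)%E -> b - a <= d - c].
Proof.
move=> a1; rewrite /SI (negbTE a1) /I_ /Ubar /=; split.
  move=> [[]]; rewrite real_part_emb !lee_fin => ab Fab minab; split=> // c d cd Fcd.
  by rewrite -lee_fin !EFinB; apply: minab; rewrite lee_fin.
move=> [ab Fab minab]; split.
  by rewrite real_part_emb !lee_fin.
move=> c d [/=]; rewrite lee_fin -/(emb (c, d)) real_part_emb => cd Fcd.
by rewrite -!EFinB lee_fin; exact: minab.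
Qed.

(** The competitor [[c, d]] excludes intervals of infinite length. The two degenerate intervals at
    infinity have length [-oo] by convention and are excluded by their empty real part. *)
Lemma SI_finite alpha F c d p : 0 < alpha -> alpha != 1 -> c <= d ->
  (alpha%:E <= F `[c, d]%classic)%E -> SI alpha F p -> exists q, p = emb q.
Proof.
move=> a0 a1 cd Fcd; rewrite /SI (negbTE a1) => -[[Up Fp]].
have Icd : I_ alpha F (emb (c, d)).
  by split; rewrite /Ubar ?real_part_emb//= lee_fin.
move=> /(_ c d Icd).
move: p Up Fp => [[a| |] [b| |]]//= Up Fp.
- by exists (a, b).
- suff e : @real_part R (+oo, +oo)%E = set0 by move: Fp; rewrite e measure0 lee_fin leNgt a0.
  by apply/seteqP; split=> z //; rewrite /real_part/= leye_eq.
- suff e : @real_part R (-oo, -oo)%E = set0 by move: Fp; rewrite e measure0 lee_fin leNgt a0.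
  by apply/seteqP; split=> z //; rewrite /real_part/= leeNy_eq andbF.
Qed.

End shortest_intervals.

Section two_points.
Context {R : realType}.
Variables (x y l : R) (F : distr R).
Hypothesis xy : x < y.
Hypothesis FE : forall B : set R, measurable B ->
  (F B = (1 - l)%:E * \d_x B + l%:E * \d_y B)%E.

Lemma two_point_itv c d :
  F `[c, d]%classic = ((1 - l) *+ (c <= x <= d)%R + l *+ (c <= y <= d)%R)%:E.
Proof.
rewrite FE// !diracE !mem_setE/= !in_itv/=.
by rewrite -(mulr_natr (1 - l)) -(mulr_natr l) [RHS]EFinD !EFinM.
Qed.

(** The atom at [x] suffices, so the optimal length is 0, and every other single point has mass at
    most [l < alpha]. *)
Lemma SI_two_point_left alpha : 0 < alpha < 1 -> l < alpha -> alpha <= 1 - l ->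
  SI alpha F = [set emb (x, x)].
Proof.
move=> /andP[a0 a1] la al.
have a1' : alpha != 1 by rewrite lt_eqF.
have Fx : (alpha%:E <= F `[x, x]%classic)%E.
  rewrite two_point_itv lexx lee_fin /= mulr1n (lt_geF xy) andbF mulr0n; lra.
apply/seteqP; split=> [p SIp|_ /= ->]; last first.
  by apply/SI_embP => //; split=> // c d cd _; rewrite subrr subr_ge0.
have [[a b] pE] := SI_finite a0 a1' (lexx x) Fx SIp; rewrite pE in SIp *.
have [ab Fab /(_ x x (lexx x) Fx)] := (SI_embP F a b a1').1 SIp.
rewrite subrr subr_le0 => ba; have {ba ab} ab : a = b by apply/le_anti/andP.
subst b; move: Fab; rewrite two_point_itv lee_fin -!eq_le.
case: eqVneq => [->//|_]; case: eqVneq => _; rewrite ?mulr1n ?mulr0n => h; exfalso; lra.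
Qed.

(** Neither atom suffices alone, so an admissible interval contains both. *)
Lemma SI_two_point_span alpha : 0 < alpha < 1 -> l < alpha -> 1 - l < alpha ->
  SI alpha F = [set emb (x, y)].
Proof.
move=> /andP[a0 a1] la al.
have a1' : alpha != 1 by rewrite lt_eqF.
have min c d : (alpha%:E <= F `[c, d]%classic)%E -> c <= x /\ y <= d.
  rewrite two_point_itv lee_fin.
  case: (boolP (c <= x <= d)) => [/andP[cx _]|_]; case: (boolP (c <= y <= d)) => [/andP[_ yd]|_];
    rewrite ?mulr1n ?mulr0n // => h; exfalso; lra.
have Fxy : (alpha%:E <= F `[x, y]%classic)%E.
  by rewrite two_point_itv !lexx (ltW xy) /= !mulr1n lee_fin; lra.
apply/seteqP; split=> [p SIp|_ /= ->]; last first.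
  apply/SI_embP => //; split=> //; first exact: ltW.
  by move=> c d cd /min[cx yd]; lra.
have [[a b] pE] := SI_finite a0 a1' (ltW xy) Fxy SIp; rewrite pE in SIp *.
have [ab /min[ax yb] /(_ x y (ltW xy) Fxy) h] := (SI_embP F a b a1').1 SIp.
have -> : a = x by lra.
by have -> : b = y by lra.
Qed.

(** Only membership is claimed: [[x, x]] may be optimal as well. *)
Lemma SI_two_point_right alpha : alpha != 1 -> alpha <= l ->
  SI alpha F (emb (y, y)).
Proof.
move=> a1 al; apply/SI_embP => //; split=> //.
  rewrite two_point_itv lexx lee_fin /= mulr1n (lt_geF xy)/= mulr0n; lra.
by move=> c d cd _; rewrite subrr subr_ge0.
Qed.

Lemma supp_two_point_left : l = 0 -> supp F = [set x].
Proof.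
move=> l0; apply/seteqP; split=> z; rewrite /supp /=.
  move=> Fz; apply: contrapT => zx.
  have oC : open (~` [set x]) by apply: closed_openC; exact: closed_eq.
  have := Fz _ oC zx; rewrite FE; last exact: open_measurable.
  by rewrite l0 subr0 mul1e mul0e adde0 diracE memNset/= ?ltxx// => /(_ erefl).
move=> -> O oO Ox; rewrite FE ?l0; last exact: open_measurable.
by rewrite subr0 mul1e mul0e adde0 diracE mem_set//= lte_fin.
Qed.

Lemma supp_two_point : 0 < l < 1 -> supp F = [set x; y].
Proof.
move=> /andP[l0 l1]; apply/seteqP; split=> z; rewrite /supp /=.
  move=> Fz; apply: contrapT => zxy.
  have oC : open (~` [set x; y]).
    by apply: closed_openC; apply: closedU; exact: closed_eq.
  have := Fz _ oC zxy; rewrite FE; last exact: open_measurable.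
  by rewrite !diracE !memNset/= ?mule0 ?adde0 ?ltxx//; apply; [right|left].
by move=> [->|->] O oO Oz; rewrite FE; do ?[exact: open_measurable];
   rewrite !diracE (mem_set Oz)/= -!EFinM -EFinD lte_fin mulr1;
   [apply: ltr_pwDl|apply: ltr_wpDl]; rewrite ?subr_gt0// mulr_ge0// ?subr_ge0 ltW.
Qed.

Lemma SI1_two_point_left : l = 0 -> SI 1 F = [set emb (x, x)].
Proof.
move=> l0; rewrite /SI eqxx /essinf /esssup supp_two_point_left//.
by rewrite image_set1 ereal_inf1 ereal_sup1.
Qed.

Lemma SI1_two_point : 0 < l < 1 -> SI 1 F = [set emb (x, y)].
Proof.
move=> l1; rewrite /SI eqxx /essinf /esssup supp_two_point//.
rewrite image_setU !image_set1.
congr [set (_, _)]; apply/le_anti/andP; split.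
- by apply: ereal_inf_lbound; left.
- by apply: le_ereal_inf_tmp => _ [->|->]; rewrite lee_fin// ltW.
- by apply: ge_ereal_sup => _ [->|->]; rewrite lee_fin// ltW.
- by apply: ereal_sup_ubound; right.
Qed.

End two_points.

(** * Exhaustive scores on two-point distributions *)

Section exhaustive.
Context {R : realType}.
Variables (x y : R).
Hypothesis xy : x < y.

Definition two_point (l : R) (l01 : 0 <= l <= 1) : distr R :=
  mix l01 (dirac (x : measurableTypeR R)) (dirac (y : measurableTypeR R)).

Lemma two_pointE l (l01 : 0 <= l <= 1) B :
  (two_point l01 B = (1 - l)%:E * \d_x B + l%:E * \d_y B)%E.
Proof. exact: mixE. Qed.

Lemma mix_two_pointE (s l1 l2 : R) (s01 : 0 <= s <= 1) (l101 : 0 <= l1 <= 1)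
    (l201 : 0 <= l2 <= 1) B :
  (mix s01 (two_point l101) (two_point l201) B =
   (1 - ((1 - s) * l1 + s * l2))%:E * \d_x B +
   ((1 - s) * l1 + s * l2)%:E * \d_y B)%E.
Proof.
rewrite mixE !two_pointE !diracE.
have e (p q : R) : (1 - s) * ((1 - l1) * p + l1 * q) + s * ((1 - l2) * p + l2 * q) =
    (1 - ((1 - s) * l1 + s * l2)) * p + ((1 - s) * l1 + s * l2) * q by ring.
exact: (congr1 EFin (e _ _)).
Qed.

Lemma two_point_exhaustive_jump (M : set (distr R)) (T : distr R -> set (\bar R * \bar R))
    (B : set (\bar R * \bar R)) l1 l2 (l101 : 0 <= l1 <= 1) (l201 : 0 <= l2 <= 1) :
  two_point_mixtures x y `<=` M -> T (two_point l101) <> B ->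
  (forall s (s01 : 0 <= s <= 1), 0 < s < 1 ->
     T (mix s01 (two_point l101) (two_point l201)) = B) ->
  ~ exhaustively_elicitable M T.
Proof.
move=> xyM TB Tmix; apply: (@exhaustive_jump _ M T (two_point l101) (two_point l201) B) => //.
- by apply: xyM; exists l1 => // C _; exact: two_pointE.
- by apply: xyM; exists l2 => // C _; exact: two_pointE.
move=> s s01 s01'; split; last exact: Tmix.
apply: xyM; exists ((1 - s) * l1 + s * l2); last by move=> C _; exact: mix_two_pointE.
by apply/andP; split; nra.
Qed.

Lemma two_point_mixtures_not_exhaustive (M : set (distr R)) alpha : 0 < alpha <= 1 ->
  two_point_mixtures x y `<=` M -> ~ exhaustively_elicitable M (SI alpha).
Proof.
move=> /andP[a0]; rewrite le_eqVlt => /predU1P[->|a1] xyM.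
  (* For [alpha = 1], the support grows from one point to two as soon as the weight of [y] leaves
     0. *)
  have l0 : 0 <= (0 : R) <= 1 by rewrite lexx ler01.
  have l1 : 0 <= (1 : R) <= 1 by rewrite lexx ler01.
  apply: (@two_point_exhaustive_jump M _ [set emb (x, y)] _ _ l0 l1) => //.
    rewrite (SI1_two_point_left (fun B _ => two_pointE l0 B))//.
    by move/seteqP => [/(_ _ erefl) [e] _]; move: xy; rewrite e ltxx.
  move=> s s01 s01'.
  by apply: (SI1_two_point xy (fun B _ => mix_two_pointE s01 l0 l1 B)); lra.
have [a2|a2] := leP alpha (1 - alpha).
  (* For [alpha <= 1 / 2], the weight of [y] decreases from exactly [alpha], so that [[y, y]] is
     lost at once and [[x, x]] alone remains. *)
  have l0 : 0 <= (0 : R) <= 1 by rewrite lexx ler01.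
  have l1 : 0 <= alpha <= 1 by lra.
  apply: (@two_point_exhaustive_jump M _ [set emb (x, x)] _ _ l1 l0) => //.
    move=> SIe; have := SI_two_point_right xy (fun B _ => two_pointE l1 B) (alpha := alpha).
    by rewrite lt_eqF// SIe => /(_ isT (lexx _)) [e _]; move: xy; rewrite e ltxx.
  move=> s s01 s01'.
  by apply: (SI_two_point_left xy (fun B _ => mix_two_pointE s01 l1 l0 B)); nra.
(* For [alpha > 1 / 2], the weight of [x] decreases from exactly [alpha] towards [1 - alpha];
   strictly in between, both atoms are needed. *)
have l1 : 0 <= alpha <= 1 by lra.
have l0 : 0 <= 1 - alpha <= 1 by lra.
apply: (@two_point_exhaustive_jump M _ [set emb (x, y)] _ _ l0 l1) => //.
  have -> : SI alpha (two_point l0) = [set emb (x, x)].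
    by apply: (SI_two_point_left xy (fun B _ => two_pointE l0 B)); lra.
  by move/seteqP => [/(_ _ erefl) [e] _]; move: xy; rewrite e ltxx.
move=> s s01 s01'.
by apply: (SI_two_point_span xy (fun B _ => mix_two_pointE s01 l0 l1 B)); nra.
Qed.

End exhaustive.

Lemma two_point_mixturesC {R : realType} (x y : R) :
  two_point_mixtures x y `<=` two_point_mixtures y x.
Proof.
move=> F [l l01 FE]; exists (1 - l); first by lra.
by move=> B mB; rewrite FE// subKr addeC.
Qed.

(** * Unimodal distributions *)

Section counting.
Context {R : realType}.
Implicit Types (F : distr R) (k n j : nat).
Local Notation N0 := (range (fun n : nat => (n%:R : R))).

Lemma measurable_range_natr : measurable (N0 : set R).
Proof.
apply: countable_measurable => //.
by apply: sub_countable (countableP [set: nat]); exact: card_image_le.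
Qed.

Lemma inv_natS_itv n : 0 <= (n.+1%:R : R)^-1 <= 1.
Proof. by rewrite invr_ge0 ler0n/= invf_le1 ?ler1n ?ltr0n. Qed.

(** The uniform law on [k, ..., k + n]: giving the new last atom weight [1 / (m + 2)] scales the
    [m + 1] earlier atoms to the same mass. *)
Fixpoint uniform_nat k n : distr R :=
  if n is m.+1 then
    mix (inv_natS_itv m.+1) (uniform_nat k m)
      (dirac ((k + m.+1)%:R : measurableTypeR R))
  else dirac (k%:R : measurableTypeR R).

Lemma pmfN_mix F1 F2 s (s01 : 0 <= s <= 1) j :
  pmfN (mix s01 F1 F2) j = ((1 - s)%:E * pmfN F1 j + s%:E * pmfN F2 j)%E.
Proof. exact: mixE. Qed.

Lemma pmfN_dirac k j :
  pmfN (dirac (k%:R : measurableTypeR R)) j = ((j == k)%:R)%:E.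
Proof.
rewrite /pmfN /= diracE; congr ((nat_of_bool _)%:R%:E).
by apply/idP/eqP => [|->]; rewrite inE//= => /eqP; rewrite eqr_nat => /eqP.
Qed.

Lemma pmfN_uniform_nat k n j :
  pmfN (uniform_nat k n) j = (((k <= j <= k + n)%N)%:R / n.+1%:R)%:E.
Proof.
elim: n => [|n IH].
  by rewrite [LHS]pmfN_dirac addn0 -eqn_leq divr1 eq_sym.
rewrite [LHS]pmfN_mix IH pmfN_dirac -!EFinM -EFinD; congr EFin.
have n1 : n.+1%:R != 0 :> R by rewrite pnatr_eq0.
have n2 : n.+2%:R != 0 :> R by rewrite pnatr_eq0.
rewrite addnS [in RHS](leq_eqVlt j) ltnS.
have -> : (1 - n.+2%:R^-1) = n.+1%:R / n.+2%:R :> R.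
  by apply: (mulIf n2); rewrite mulrBl mulVf// divfK// mul1r -natr1 addrK.
case: eqVneq => [->|_]/=; last first.
  by move: (n.+1%:R : R) (n.+2%:R : R) n1 n2 => p q p0 q0; field; rewrite p0 q0.
rewrite ltnn !andbF mul0r mulr0 add0r leqW ?leq_addr//=.
by rewrite mulrC.
Qed.

Lemma unimodal_dirac k : unimodal k (dirac (k%:R : measurableTypeR R)).
Proof.
split=> [|m n /andP[mn nk]|m n /andP[km mn]].
- by rewrite /= diracE mem_set//; exists k.
- rewrite !pmfN_dirac lee_fin ler_nat; case: eqP => // mk.
  by rewrite (_ : n == k)// eqn_leq nk -mk.
- rewrite !pmfN_dirac lee_fin ler_nat; case: eqP => // nk.
  by rewrite (_ : m == k)// eqn_leq km -nk mn.
Qed.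

Lemma unimodal_mix k F1 F2 s (s01 : 0 <= s <= 1) :
  unimodal k F1 -> unimodal k F2 -> unimodal k (mix s01 F1 F2).
Proof.
move=> [F11 F1u F1d] [F21 F2u F2d]; case/andP : (s01) => s0 s1.
split=> [|m n mn|m n mn].
- by rewrite [LHS]mixE F11 F21 !mule1 -EFinD subrK.
- rewrite !pmfN_mix leeD// lee_wpmul2l ?lee_fin ?subr_ge0//; [exact: F1u|exact: F2u].
- rewrite !pmfN_mix leeD// lee_wpmul2l ?lee_fin ?subr_ge0//; [exact: F1d|exact: F2d].
Qed.

Lemma unimodal_uniform_nat k n : unimodal k (uniform_nat k n).
Proof.
split=> [|i j /andP[ij jk]|i j /andP[ki ij]].
- elim: n => [|n IH]; first by rewrite /= diracE mem_set//; exists k.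
  rewrite [LHS]mixE IH /= diracE mem_set; last by exists (k + n.+1)%N.
  by rewrite !mule1 -EFinD subrK.
- rewrite !pmfN_uniform_nat lee_fin ler_pM2r ?invr_gt0 ?ltr0n// ler_nat.
  by case: (boolP (k <= i <= k + n)%N) => //= h; rewrite (_ : (k <= j <= k + n)%N)//; lia.
- rewrite !pmfN_uniform_nat lee_fin ler_pM2r ?invr_gt0 ?ltr0n// ler_nat.
  by case: (boolP (k <= j <= k + n)%N) => //= h; rewrite (_ : (k <= i <= k + n)%N)//; lia.
Qed.

(** An interval shorter than 1 contains at most one natural number, and the complement of [N0] is a
    null set. *)
Lemma short_itv_le_pmfN F c d : F N0 = 1%E -> d - c < 1 ->
  exists j, (F `[c, d]%classic <= pmfN F j)%E.
Proof.
move=> FN dc; have mN := measurable_range_natr.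
have FCN : F (~` N0) = 0%E by rewrite probability_setC// FN subee.
have [[j [cj jd]]|h] := pselect (exists j : nat, c <= j%:R /\ j%:R <= d).
  exists j; rewrite -[leRHS]adde0 -FCN.
  apply: (le_trans _ (measureU2 _ _ _)) => //; last exact: measurableC.
  apply: le_measure; rewrite ?inE//.
    by apply: measurableU => //; exact: measurableC.
  move=> z /=; rewrite in_itv/= => /andP[cz zd].
  have [[i _ iz]|] := pselect (N0 z); last by right.
  left; rewrite -iz in cz zd *; congr (_%:R).
  have : (i%:R < j.+1%:R :> R) by rewrite -natr1; lra.
  have : (j%:R < i.+1%:R :> R) by rewrite -natr1; lra.
  by rewrite !ltr_nat; lia.
(* No natural number lies in the interval, which is then null; the index 0 is arbitrary. *)
exists 0%N; apply: (@le_trans _ _ 0%E) => //; rewrite -FCN.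
apply: le_measure; rewrite ?inE//; first exact: measurableC.
move=> z /=; rewrite in_itv/= => /andP[cz zd] [i _ iz].
by apply: h; exists i; rewrite iz.
Qed.

Lemma itv_natS_ge F k :
  (pmfN F k + pmfN F k.+1 <= F `[k%:R, k.+1%:R]%classic)%E.
Proof.
rewrite /pmfN -measureU//; last first.
  by apply/seteqP; split=> z //= [->] /eqP; rewrite eqr_nat => /eqP; lia.
apply: le_measure; rewrite ?inE//; first exact: measurableU.
by move=> z /= [->|->]; rewrite in_itv/= !ler_nat; lia.
Qed.

End counting.

Section unimodal_case.
Context {R : realType}.

(** Take the integer part [n] of [1 / alpha]: then [1 < alpha (n + 1) <= 1 + alpha <= 2]. A uniform
    law on [n + 1] points thus needs exactly two atoms to reach [alpha]. *)
Lemma reciprocal_bracket (alpha : R) : 0 < alpha < 1 ->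
  exists2 n : nat, (0 < n)%N & (n.+1%:R)^-1 < alpha <= 2 * (n.+1%:R)^-1.
Proof.
move=> /andP[a0 a1]; have a0' : 0 < alpha^-1 by rewrite invr_gt0.
have ai1 : 1 < alpha^-1 by rewrite invf_gt1.
have := truncn_itv (ltW a0'); set n := Num.truncn _ => /andP[nle ltn].
have n0 : (0 < n)%N by rewrite lt0n; apply/eqP => n0; move: ltn; rewrite n0; lra.
have nn : 0 < n.+1%:R :> R by rewrite ltr0n.
exists n => //; apply/andP; split.
  by rewrite -[alpha]invrK ltf_pV2.
rewrite ler_pdivlMr//.
have : alpha * n%:R <= 1 by rewrite -[leRHS](divff (lt0r_neq0 a0)) ler_pM2l.
by rewrite -natr1; lra.
Qed.

Lemma unimodal_not_selective (M : set (distr R)) k alpha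
    (S : R * R -> R -> \bar R) : 0 < alpha < 1 -> unimodal k `<=` M ->
  scoring_function (@U R) M S -> ~ sel_strictly_consistent M (SI alpha) S.
Proof.
move=> a01 kM scS cS; have [n n0] := reciprocal_bracket a01.
case/andP: (a01) => a0 a1; have a1' : alpha != 1 by rewrite lt_eqF.
have u0 : 0 < (n.+1%:R)^-1 :> R by rewrite invr_gt0.
move uE : (n.+1%:R)^-1 => u in u0 *; move=> /andP[ua au].
(* This weight solves [(1 - s0) + s0 u = alpha], so that the mode of [P] has mass exactly
   [alpha]. *)
pose s0 := (1 - alpha) / (1 - u).
have u1 : 0 < 1 - u by lra.
have s0E : s0 * (1 - u) = 1 - alpha by rewrite /s0 divfK// gt_eqF.
have s0gt0 : 0 < s0 by rewrite divr_gt0//; lra.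
have s0lt1 : s0 < 1 by rewrite ltr_pdivrMr//; lra.
clearbody s0; have s001 : 0 <= s0 <= 1 by lra.
pose Q := @uniform_nat R k n.
pose P := mix s001 (dirac (k%:R : measurableTypeR R)) Q.
have uQ : unimodal k Q by exact: unimodal_uniform_nat.
have uP : unimodal k P by apply: unimodal_mix => //; exact: unimodal_dirac.
have PE j : pmfN P j =
    ((1 - s0) * (j == k)%:R + s0 * ((k <= j <= k + n)%N%:R * u))%:E.
  by rewrite [LHS]pmfN_mix pmfN_dirac pmfN_uniform_nat uE.
have QE j : pmfN Q j = ((k <= j <= k + n)%N%:R * u)%:E.
  by rewrite pmfN_uniform_nat uE.
have kn : (k <= k <= k + n)%N by rewrite leqnn leq_addr.
have kSn : (k <= k.+1 <= k + n)%N by rewrite leqnSn -addn1 leq_add2l.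
have Sk : (k.+1 == k) = false by rewrite gtn_eqF.
pose t : R * R := (k%:R, k%:R); pose t' : R * R := (k%:R, k.+1%:R).
have Ut : U t by rewrite /U/=.
have Ut' : U t' by rewrite /U/= ler_nat.
have Pt : SI alpha P (emb t).
  apply/SI_embP => //; split=> //; last by move=> c d cd _; rewrite subrr subr_ge0.
  rewrite set_itv1 -/(pmfN P k) PE eqxx kn lee_fin/=; nra.
have Pt' : ~ SI alpha P (emb t').
  move=> /SI_embP-/(_ a1')[_ _ /(_ k%:R k%:R (lexx _))].
  rewrite set_itv1 -/(pmfN P k) PE eqxx kn lee_fin -natr1/=.
  have h : alpha <= (1 - s0) * 1%:R + s0 * (1%:R * u) by nra.
  by move/(_ h); lra.
have tt' : (sbar S t P < sbar S t' P)%E.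
  by apply: (sel_strictly_consistent_lt cS) => //; exact: kM.
(* The strict preference for [t] over [t'] makes the score of [t] finite under [P], a proper mixture
   with component [Q]. *)
have tQ : (sbar S t Q < +oo)%E.
  have tP := lt_le_trans tt' (leey _).
  apply: (sbar_mix_ltey scS Ut _ _ _ tP).2; last lra.
    exact/kM/unimodal_dirac.
  exact: kM.
apply: (selective_jump scS cS (kM _ uP) (kM _ uQ) Ut Ut' Pt Pt' _ tQ).
move=> s s01 /andP[sgt0 slt1].
have uF : unimodal k (mix s01 P Q) by exact: unimodal_mix.
have FE j : pmfN (mix s01 P Q) j = ((1 - s) * ((1 - s0) * (j == k)%:R +
    s0 * ((k <= j <= k + n)%N%:R * u)) + s * ((k <= j <= k + n)%N%:R * u))%:E.
  by rewrite pmfN_mix PE QE.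
(* The mode now has mass [(1 - s) alpha + s u < alpha], and every other atom at most [u]. *)
have F_lt j : (pmfN (mix s01 P Q) j < alpha%:E)%E.
  rewrite FE lte_fin; case: eqVneq => [->|_].
    rewrite kn/=; nra.
  case: (k <= j <= k + n)%N => /=; nra.
split; first exact: kM.
- apply/SI_embP => //; split=> //.
  + apply: le_trans (itv_natS_ge _ _).
    rewrite !FE eqxx kn kSn Sk -EFinD lee_fin/=.
    have h1 : (1 - s) * (s0 * (1 - u)) = (1 - s) * (1 - alpha) by rewrite s0E.
    have h2 : 0 <= (1 - s) * (s0 * u) by rewrite !mulr_ge0//; lra.
    have h3 : 0 <= s * (2 * u - alpha) by rewrite mulr_ge0//; lra.
    lra.
  + move=> c d cd Fcd; rewrite -natr1 addrAC subrr add0r leNgt; apply/negP.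
    move=> /(short_itv_le_pmfN (let: And3 F1 _ _ := uF in F1))[j].
    by rewrite leNgt (lt_le_trans (F_lt j) Fcd).
- move=> /SI_embP-/(_ a1')[_ + _].
  by rewrite set_itv1 leNgt F_lt.
Qed.

End unimodal_case.

(** * Bounded densities *)

Section densities.
Context {R : realType}.
Implicit Types (M : set (distr R)) (a b c d : R).

Lemma bounded_density_uniform a b (ab : a < b) :
  bounded_density (uniform_prob ab : distr R).
Proof.
exists (uniform_pdf a b); split=> //.
- exact: measurable_uniform_pdf.
- by move=> y; exact: uniform_pdf_ge0.
- exists (b - a)^-1 => y; rewrite /uniform_pdf; case: ifP => // _.
  by rewrite invr_ge0 subr_ge0 ltW.
Qed.

Lemma bounded_density_mix (F1 F2 : distr R) s (s01 : 0 <= s <= 1) :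
  bounded_density F1 -> bounded_density F2 -> bounded_density (mix s01 F1 F2).
Proof.
case/andP: (s01) => s0 s1; rewrite -subr_ge0 in s1.
move=> [f [mf f0 [Cf hCf] F1E]] [g [mg g0 [Cg hCg] F2E]].
exists (fun y => (1 - s) * f y + s * g y); split.
- by apply: measurable_funD; apply: measurable_funM.
- by move=> y; rewrite addr_ge0// mulr_ge0.
- by exists ((1 - s) * Cf + s * Cg) => y; rewrite lerD// ler_wpM2l.
- move=> B mB; rewrite [LHS]mixE F1E// F2E//.
  under [RHS]eq_integral do rewrite EFinD !EFinM.
  rewrite ge0_integralD//.
  + rewrite !ge0_integralZl//; try by move=> y _; rewrite lee_fin.
      by apply/measurable_EFinP; exact: measurable_funTS.
    by apply/measurable_EFinP; exact: measurable_funTS.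
  + by move=> y _; rewrite mule_ge0 ?lee_fin.
  + apply: measurable_funeM; apply/measurable_EFinP; exact: measurable_funTS.
  + by move=> y _; rewrite mule_ge0 ?lee_fin.
  + apply: measurable_funeM; apply/measurable_EFinP; exact: measurable_funTS.
Qed.

Lemma uniform_probE a b (ab : a < b) (B : set R) : measurable B ->
  uniform_prob ab B = ((b - a)^-1%:E * lebesgue_measure (B `&` `[a, b]))%E.
Proof.
move=> mB; have mI : measurable (B `&` `[a, b]%classic) by exact: measurableI.
rewrite /uniform_prob integral_uniform_pdf -integral_cst//.
apply: eq_integral => y; rewrite inE/= in_itv/= => -[_ yab].
by rewrite /uniform_pdf yab.
Qed.

(** The covering interval [[c', d']] is left free: taking [[c, d]], a clipped piece of it or a
    single point yields the length bound, the strict bound and the vanishing below. *)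
Lemma uniform_prob_itv_le a b (ab : a < b) c d c' d' : c' <= d' ->
  (forall z, c <= z <= d -> a <= z <= b -> c' <= z <= d') ->
  (uniform_prob ab `[c, d]%classic <= ((d' - c') / (b - a))%:E)%E.
Proof.
move=> cd' h; rewrite uniform_probE// mulrC EFinM lee_wpmul2l//.
  by rewrite lee_fin invr_ge0 subr_ge0 ltW.
have <- : lebesgue_measure (`[c', d']%classic : set R) = (d' - c')%:E.
  rewrite lebesgue_measure_itv/= lte_fin; case: ltP => // ?.
  by congr EFin; lra.
apply: le_measure; rewrite ?inE//; first exact: measurableI.
by move=> z /= []; rewrite !in_itv/= => zcd zab; apply: h.
Qed.

Lemma uniform_prob_itv0 a b (ab : a < b) c d : d < a \/ b < c ->
  uniform_prob ab `[c, d]%classic = 0%E.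
Proof.
move=> h; apply/le_anti/andP; split; last exact: measure_ge0.
have -> : 0%E = ((a - a) / (b - a))%:E :> \bar R by rewrite subrr mul0r.
by apply: uniform_prob_itv_le => // z ? ?; lra.
Qed.

Lemma uniform_prob_itv1 a b (ab : a < b) c d : c <= a -> b <= d ->
  uniform_prob ab `[c, d]%classic = 1%E.
Proof.
move=> ca bd; rewrite [LHS]integral_uniform_pdf1//.
by move=> z; rewrite /= !in_itv/=; lra.
Qed.

Lemma uniform_prob_itv_lt1 a b (ab : a < b) c d : a < c \/ d < b ->
  (uniform_prob ab `[c, d]%classic < 1)%E.
Proof.
have ba : 0 < b - a by rewrite subr_gt0.
move=> [ac|db].
- have [cb|bc] := leP c b; last by rewrite uniform_prob_itv0 ?lte_fin//; right.
  apply: (@le_lt_trans _ _ ((b - c) / (b - a))%:E).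
    by apply: uniform_prob_itv_le => // z ? ?; lra.
  by rewrite lte_fin ltr_pdivrMr// mul1r; lra.
- have [ad|da] := leP a d; last by rewrite uniform_prob_itv0 ?lte_fin//; left.
  apply: (@le_lt_trans _ _ ((d - a) / (b - a))%:E).
    by apply: uniform_prob_itv_le => // z ? ?; lra.
  by rewrite lte_fin ltr_pdivrMr// mul1r; lra.
Qed.

(** Gathers the bounds on one real number, so that comparisons of intervals become real
    arithmetic. *)
Lemma uniform_prob_itv_fin a b (ab : a < b) c d : c <= d ->
  exists2 p : R, uniform_prob ab `[c, d]%classic = p%:E &
    [/\ 0 <= p <= 1, p * (b - a) <= d - c,
        c <= a -> b <= d -> p = 1,
        d < a \/ b < c -> p = 0 & a < c \/ d < b -> p < 1].
Proof.
move=> cd; have ba : 0 < b - a by rewrite subr_gt0.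
exists (fine (uniform_prob ab `[c, d]%classic)).
  by rewrite fineK// fin_num_measure.
split.
- rewrite fine_ge0//= -lee_fin fineK ?fin_num_measure//.
  exact: probability_le1.
- rewrite -ler_pdivlMr// -lee_fin fineK ?fin_num_measure//.
  exact: uniform_prob_itv_le.
- by move=> ca bd; rewrite uniform_prob_itv1.
- by move=> h; rewrite uniform_prob_itv0.
- by move=> h; rewrite -lte_fin fineK ?fin_num_measure// uniform_prob_itv_lt1.
Qed.

Lemma mix_itvE s (s01 : 0 <= s <= 1) (F1 F2 : distr R) c d p q :
  F1 `[c, d]%classic = p%:E -> F2 `[c, d]%classic = q%:E ->
  mix s01 F1 F2 `[c, d]%classic = ((1 - s) * p + s * q)%:E.
Proof. by move=> F1E F2E; rewrite mixE F1E F2E. Qed.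

(** A competitor shorter than 1 that ends before [z] meets only the first block and covers less than
    all of it. One reaching [z >= 2] misses [[0, 1]], and its mass is at most [(1 - alpha) / K],
    below [alpha]. *)
Lemma SI_isolated_unit_itv alpha z K (a01 : 0 < alpha < 1)
    (s01 : 0 <= 1 - alpha <= 1) (zK : z < z + K) :
  2 <= z -> 1 <= alpha * K ->
  SI alpha (mix s01 (uniform_prob (@ltr01 R)) (uniform_prob zK)) (emb (0, 1)).
Proof.
move=> z2 aK; case/andP: (a01) => a0 a1.
apply/SI_embP; first by rewrite lt_eqF.
split=> //.
  have [p pE [/andP[p0 p_le1] _ p1 _ _]] := uniform_prob_itv_fin (@ltr01 R) (@ler01 R).
  have [q qE [/andP[q0 q_le1] _ _ _ _]] := uniform_prob_itv_fin zK (@ler01 R).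
  by rewrite [leRHS](mix_itvE s01 pE qE) lee_fin p1//; nra.
move=> c d cd.
have [p pE [/andP[p0 p_le1] pcd _ pout _]] := uniform_prob_itv_fin (@ltr01 R) cd.
have [q qE [/andP[q0 q_le1] qcd _ qout _]] := uniform_prob_itv_fin zK cd.
rewrite [leRHS](mix_itvE s01 pE qE) lee_fin => h; rewrite leNgt; apply/negP => dc.
have [dz|zd] := ltP d z.
  by rewrite qout ?mulr0 ?addr0 in h; [nra|left].
rewrite pout in h; last by right; lra.
have : (1 - alpha) * (alpha * (q * K)) <= (1 - alpha) * (alpha * (d - c)).
  by rewrite !ler_pM2l//; lra.
have : q <= q * (alpha * K) by rewrite ler_peMr.
nra.
Qed.

(** The blocks [[0, 1]] and [[3, 3 + K]] share mass exactly [alpha], both with positive weight, so a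
    shorter interval near them loses mass. One reaching [z] starts beyond [3 + K] and meets only the
    thin block. *)
Lemma SI_spread alpha K z K' s (a01 : 0 < alpha < 1)
    (b01 : 0 <= 1 - alpha <= 1) (s01 : 0 <= s <= 1)
    (wK : 3 < 3 + K) (zK : z < z + K') : 0 < s < 1 ->
  2 * (3 + K) <= z -> 3 + K <= alpha * K' ->
  let F := mix s01 (mix b01 (uniform_prob (@ltr01 R)) (uniform_prob zK))
                   (mix b01 (uniform_prob wK) (uniform_prob zK)) in
  SI alpha F (emb (0, 3 + K)) /\ ~ SI alpha F (emb (0, 1)).
Proof.
move=> /andP[s0 s1] zge aK' F; case/andP: (a01) => a0 a1.
have a1' : alpha != 1 by rewrite lt_eqF.
have L0 : 0 <= 3 + K by lra.
split.
  apply/SI_embP => //; split=> //.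
    have [p pE [_ _ p1 _ _]] := uniform_prob_itv_fin (@ltr01 R) L0.
    have [w wE [_ _ w1 _ _]] := uniform_prob_itv_fin wK L0.
    have [v vE [/andP[v0 v_le1] _ _ _ _]] := uniform_prob_itv_fin zK L0.
    rewrite [leRHS](mix_itvE s01 (mix_itvE b01 pE vE) (mix_itvE b01 wE vE)) lee_fin.
    by rewrite p1 ?w1//; nra.
  move=> c d cd.
  have [p pE [/andP[p0 p_le1] _ _ pout plt]] := uniform_prob_itv_fin (@ltr01 R) cd.
  have [w wE [/andP[w0 w_le1] _ _ wout wlt]] := uniform_prob_itv_fin wK cd.
  have [v vE [/andP[v0 v_le1] vcd _ vout _]] := uniform_prob_itv_fin zK cd.
  rewrite [leRHS](mix_itvE s01 (mix_itvE b01 pE vE) (mix_itvE b01 wE vE)) lee_fin => h.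
  rewrite leNgt; apply/negP => dc.
  have [dz|zd] := ltP d z.
    rewrite vout ?mulr0 ?addr0 in h; last by left.
    have ps1 : (1 - s) * p + s * w < 1.
      (* The competitor cuts the left block if [0 < c]; otherwise its length forces it to cut the
         right one. *)
      have [c0|c0] := ltP 0 c.
        have := plt (or_introl c0); nra.
      have dK : d < 3 + K by lra.
      have := wlt (or_intror dK); nra.
    have : alpha * ((1 - s) * p + s * w) < alpha * 1 by rewrite ltr_pM2l.
    lra.
  rewrite pout in h; last by right; lra.
  rewrite wout in h; last by right; lra.
  have : (1 - alpha) * (alpha * (v * K')) <= (1 - alpha) * (alpha * (d - c)).
    by rewrite !ler_pM2l//; lra.
  nra.
move=> /SI_embP-/(_ a1')[_ + _].
have [p pE [_ _ p1 _ _]] := uniform_prob_itv_fin (@ltr01 R) (@ler01 R).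
have [w wE [_ _ _ w0 _]] := uniform_prob_itv_fin wK (@ler01 R).
have [v vE [_ _ _ v0 _]] := uniform_prob_itv_fin zK (@ler01 R).
rewrite [leRHS](mix_itvE s01 (mix_itvE b01 pE vE) (mix_itvE b01 wE vE)) lee_fin.
rewrite w0 ?v0 ?p1//; [nra|left;lra|left;lra].
Qed.

Lemma bounded_density_not_selective M alpha (S : R * R -> R -> \bar R) :
  0 < alpha < 1 -> @bounded_density R `<=` M ->
  scoring_function (@U R) M S -> ~ sel_strictly_consistent M (SI alpha) S.
Proof.
move=> a01 bM scS cS; case/andP: (a01) => a0 a1.
have a1' : alpha != 1 by rewrite lt_eqF.
have b01 : 0 <= 1 - alpha <= 1 by lra.
have b01' : 0 < 1 - alpha < 1 by lra.
have aV : alpha * alpha^-1 = 1 by rewrite divff// gt_eqF.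
have K0 : 0 < alpha^-1 by rewrite invr_gt0.
(* The widths [K = 1 / alpha] and [K' = (3 + K) / alpha] meet the thinness conditions
   [1 <= alpha * K] and [3 + K <= alpha * K'] with equality. *)
set K := alpha^-1 in aV K0 *; clearbody K.
pose K' := (3 + K) * K; have K'0 : 0 < K' by rewrite mulr_gt0//; lra.
have aK' : alpha * K' = 3 + K by rewrite /K' mulrCA aV mulr1.
clearbody K'; pose z := 2 * (3 + K).
have wK : 3 < 3 + K by lra.
have zK : z < z + K' by lra.
pose A : distr R := uniform_prob (@ltr01 R).
pose W : distr R := uniform_prob wK.
pose V : distr R := uniform_prob zK.
have bA : bounded_density A := bounded_density_uniform _.
have bW : bounded_density W := bounded_density_uniform _.
have bV : bounded_density V := bounded_density_uniform _.
pose t : R * R := (0, 1); pose t' : R * R := (0, 3 + K).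
have Ut : U t by rewrite /U/= ler01.
have Ut' : U t' by rewrite /U/=; lra.
have SIt F : SI alpha F (emb t) -> ~ SI alpha F (emb t').
  move=> /SI_embP-/(_ a1')[_ Ft _] /SI_embP-/(_ a1')[_ _ /(_ _ _ (@ler01 R) Ft)].
  lra.
(* Under [mix b01 A W] the interval [[0, 1]] is still optimal, so its expected
   score is finite under [W], even though [S] need not be [M]-finite. *)
have t_ltey D : bounded_density D -> SI alpha (mix b01 A D) (emb t) ->
    (sbar S t D < +oo)%E.
  move=> bD tD; apply: (sbar_mix_ltey scS Ut (bM _ bA) (bM _ bD) b01' _).2.
  apply: (lt_le_trans _ (leey (sbar S t' (mix b01 A D)))).
  apply: (sel_strictly_consistent_lt cS) => //; last exact: SIt.
  by apply: bM; exact: bounded_density_mix.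
have tW : (sbar S t W < +oo)%E.
  by apply: t_ltey => //; apply: SI_isolated_unit_itv => //; lra.
have tAV : SI alpha (mix b01 A V) (emb t).
  by apply: SI_isolated_unit_itv => //; rewrite /z; lra.
have tV : (sbar S t V < +oo)%E by exact: t_ltey.
have MP : M (mix b01 A V) by apply: bM; exact: bounded_density_mix.
have MQ : M (mix b01 W V) by apply: bM; exact: bounded_density_mix.
apply: (selective_jump scS cS MP MQ Ut Ut' tAV (SIt _ tAV)).
  move=> s s01 s01'; split.
  - by apply: bM; do ![apply: bounded_density_mix => //].
  - by apply: (SI_spread a01 b01 s01 wK zK s01' _ _).1; rewrite ?aK'.
  - by apply: (SI_spread a01 b01 s01 wK zK s01' _ _).2; rewrite ?aK'.
(* It remains to see that the score of [t] is finite under [mix b01 W V], which follows from [tW]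
   and [tV] by affinity. *)
have [_ mS fS] := scS t Ut.
rewrite sbar_mix//; [|exact/fS/bM|exact/fS/bM].
by rewrite lte_add_pinfty// lte_mul_pinfty// ?lee_fin; lra.
Qed.

End densities.

Theorem theorem4p16 (R : realType) (M : set (distr R)) :
  (forall alpha : R, 0 < alpha < 1 ->
     (@bounded_density R `<=` M \/
      (exists k : nat, (1 <= k)%N /\ @unimodal R k `<=` M)) ->
     ~ selectively_elicitable M (SI alpha) /\
     ~ (exists S : R * R -> R -> \bar R,
          scoring_function (@U R) M S /\
          sel_strictly_consistent M (SI alpha) S)) /\
  (forall alpha : R, 0 < alpha <= 1 ->
     (exists x y : R, x != y /\ two_point_mixtures x y `<=` M) ->
     ~ exhaustively_elicitable M (SI alpha)).
Proof.
split=> [alpha a01 hM|alpha a01 [x [y [xy xyM]]]].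
  have no_score (S : R * R -> R -> \bar R) : scoring_function (@U R) M S ->
      ~ sel_strictly_consistent M (SI alpha) S.
    case: hM => [bM|[k [_ kM]]]; first exact: (bounded_density_not_selective a01 bM).
    exact: (unimodal_not_selective a01 kM).
  by split=> [[S [scS _ cS]]|[S [scS cS]]]; exact: (no_score S).
have [ltxy|ltyx|exy] := ltgtP x y; last by rewrite exy eqxx in xy.
  exact: (two_point_mixtures_not_exhaustive ltxy).
apply: (two_point_mixtures_not_exhaustive ltyx) => //.
exact: subset_trans (@two_point_mixturesC _ _ _) xyM.
Qed.
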